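(* Let $R=\{(1,0),(0,2),(1,1),(1,2),(3,0),(3,1),(3,2),(3,3)\}$ and let $\mathrm{P}_{11}=(123,R)$ and $\mathrm{P}_{12}=(132,R)$ be mesh patterns. For every $n\ge 1$ and all integers $k,\ell\ge 0$, $$|\{\sigma\in\mathfrak{S}_n: \mathrm{P}_{11}(\sigma)=k,\ \mathrm{P}_{12}(\sigma)=\ell\}| = |\{\sigma\in\mathfrak{S}_n: \mathrm{P}_{12}(\sigma)=k,\ \mathrm{P}_{11}(\sigma)=\ell\}|.$$
   Context: $\mathfrak{S}_n$ is the set of permutations $\sigma=\sigma_1\sigma_2\cdots\sigma_n$ of $[n]=\{1,\dots,n\}$ in one-line notation. A mesh pattern is a pair $p=(\pi,R)$ with $\pi\in\mathfrak{S}_m$ and $R\subseteq\{0,\dots,m\}\times\{0,\dots,m\}$ (the set of shaded unit cells, each given by its bottom-left corner, in the grid with dots at $(i,\pi_i)$). An occurrence of $p$ in $\sigma\in\mathfrak{S}_n$ is a choice of indices $i_1<\cdots<i_m$ such that $\sigma_{i_1}\cdots\sigma_{i_m}$ is order-isomorphic to $\pi$ and, for every $(a,b)\in R$, there is no index $r$ with $i_a<r<i_{a+1}$ and $v_b<\sigma_r<v_{b+1}$; here $v_1<\cdots<v_m$ is the increasing rearrangement of $\sigma_{i_1},\dots,\sigma_{i_m}$, $i_0=v_0=0$ and $i_{m+1}=v_{m+1}=n+1$. $p(\sigma)$ denotes the number of occurrences of $p$ in $\sigma$. *)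

(* Defs.v *)
From mathcomp Require Import all_boot all_fingroup.

Set Implicit Arguments.
Unset Strict Implicit.
Unset Printing Implicit Defensive.

(* Permutations of [n] = {1, ..., n} are elements of 'S_n, whose positions and
   values lie in {0, ..., n-1}; the position i and the value sigma i are thus
   represented in [n] by i.+1 and (sigma i).+1. Cells of the grid of a
   pattern of length m are indexed by {0, ..., m} x {0, ..., m}, unshifted. *)

Record mesh_pattern (m : nat) := MeshPattern {
  mesh_perm : 'S_m;
  mesh_shading : {set 'I_m.+1 * 'I_m.+1} }.

Section Occurrences.
Variables (m n : nat).
Implicit Types (p : mesh_pattern m) (s : 'S_n) (f : {ffun 'I_m -> 'I_n}).

Definition increasing_indices f : bool :=
  [forall a : 'I_m, forall b : 'I_m, (a < b) ==> (f a < f b)].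

Definition order_isomorphic (pi : 'S_m) s f : bool :=
  [forall a : 'I_m, forall b : 'I_m, (pi a < pi b) == (s (f a) < s (f b))].

(* i_0 = 0, i_1, ..., i_m, i_(m+1) = n + 1, with 1-based positions *)
Definition position_bounds f : seq nat :=
  0 :: rcons [seq (f a).+1 | a <- enum 'I_m] n.+1.

(* v_0 = 0, v_1 < ... < v_m, v_(m+1) = n + 1, with 1-based values *)
Definition value_bounds s f : seq nat :=
  0 :: rcons (sort leq [seq (s (f a)).+1 | a <- enum 'I_m]) n.+1.

Definition in_cell s f (c : 'I_m.+1 * 'I_m.+1) (r : 'I_n) : bool :=
  let i := nth 0 (position_bounds f) in
  let v := nth 0 (value_bounds s f) in
  (i c.1 < r.+1 < i c.1.+1) && (v c.2 < (s r).+1 < v c.2.+1).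

Definition is_occurrence p s f : bool :=
  [&& increasing_indices f,
      order_isomorphic (mesh_perm p) s f
    & [forall c in mesh_shading p, forall r : 'I_n, ~~ in_cell s f c r]].

Definition occurrences p s : nat := #|[set f | is_occurrence p s f]|.

End Occurrences.

Definition shadingR : {set 'I_4 * 'I_4} :=
  [set c : 'I_4 * 'I_4 | (val c.1, val c.2) \in
    [:: (1, 0); (0, 2); (1, 1); (1, 2); (3, 0); (3, 1); (3, 2); (3, 3)]].

Definition perm123 : 'S_3 := 1%g.

Definition perm132 : 'S_3 := tperm (@Ordinal 3 1 isT) (@Ordinal 3 2 isT).

Definition P11 : mesh_pattern 3 := MeshPattern perm123 shadingR.

Definition P12 : mesh_pattern 3 := MeshPattern perm132 shadingR.

(* Main.v *)
Require Import Defs.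
From mathcomp Require Import all_boot all_fingroup.
From mathcomp Require Import zify.

Set Implicit Arguments.
Unset Strict Implicit.
Unset Printing Implicit Defensive.

(** Let t be the last value of a permutation, call a value small if it is below
t and large if it is above t. Column 3 of the shading forces an occurrence of
either pattern to end at the last position, so t plays the role of the 3 of
123 or of the 2 of 132. The rest of the shading says that the middle letter
is closer to t than every earlier letter on its own side of t, and that the
first letter is the last small letter before it. Hence an occurrence is
determined by its middle letter, and (lemma [occurrences_records])
- P11 counts the left-to-right maxima of the word of small letters, the first
  one excepted;
- P12 counts the left-to-right minima of the word of large letters that have
  a small letter before them.

Both numbers behave in the same way when a permutation is built by inserting
letters just before the last one. If t is not the least value, some small
letter is already present; among the values that the new letter can take,
exactly one (just below t) creates an occurrence of P11, exactly one (just
above t) creates an occurrence of P12, and the others change nothing. If t is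
the least value, no choice creates an occurrence. This is
[records_insert_letter]. Since old records survive, induction on the length
shows that the pair of statistics, taken jointly with the truth value of
0 < t, has a symmetric distribution ([sum_records_sym]). *)

(** * Records with respect to the last value *)

Definition below_last N (s : 'S_N.+1) (i : 'I_N.+1) : bool := s i < s ord_max.

Definition strictly_between (a b c : nat) : bool := (a < c < b) || (b < c < a).

(** The boolean selects the pattern throughout: [true] stands for P11, whose
middle value is small, and [false] for P12, whose middle value is large. *)
Definition on_side (b : bool) (x y : nat) : bool := if b then x < y else y < x.

(** The middle letters of occurrences: closer to the last value than every
earlier letter on the same side, and preceded by a small letter. *)
Definition is_record b N (s : 'S_N.+1) (i : 'I_N.+1) : bool :=
  [&& on_side b (s i) (s ord_max),
      [exists p : 'I_N.+1, (p < i) && below_last s p]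
    & [forall p : 'I_N.+1, (p < i) ==>
        ~~ strictly_between (s i) (s ord_max) (s p)]].

Definition records b N (s : 'S_N.+1) : nat := #|[set i | is_record b s i]|.

Definition pattern b : mesh_pattern 3 := if b then P11 else P12.

(** * Occurrences are counted by records *)

Definition o0 : 'I_3 := @Ordinal 3 0 isT.
Definition o1 : 'I_3 := @Ordinal 3 1 isT.
Definition o2 : 'I_3 := @Ordinal 3 2 isT.

Lemma forall_ord3 (P : pred 'I_3) : [forall a, P a] = [&& P o0, P o1 & P o2].
Proof.
apply/forallP/and3P => [H | [H0 H1 H2] a]; first by split.
by case: a => [[|[|[|//]]] h]; [move: H0 | move: H1 | move: H2];
  congr (is_true (P _)); apply: val_inj.
Qed.

Lemma enum_ord3 : enum 'I_3 = [:: o0; o1; o2].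
Proof. by apply: (inj_map val_inj); rewrite val_enum_ord. Qed.

Lemma position_boundsE n (f : {ffun 'I_3 -> 'I_n}) :
  position_bounds f = [:: 0; (f o0).+1; (f o1).+1; (f o2).+1; n.+1].
Proof.
by rewrite /position_bounds enum_ord3.
Qed.

(** In both patterns the first letter is the least one, so that only the order
of the other two distinguishes the patterns. *)
Lemma value_boundsE b n (s : 'S_n) (f : {ffun 'I_3 -> 'I_n}) :
  s (f o0) < s (f o1) -> s (f o0) < s (f o2) ->
  on_side b (s (f o1)) (s (f o2)) ->
  value_bounds s f = [:: 0; (s (f o0)).+1; (minn (s (f o1)) (s (f o2))).+1;
                         (maxn (s (f o1)) (s (f o2))).+1; n.+1].
Proof.
move=> h01 h02 h12; rewrite /value_bounds enum_ord3 /=; case: b h12 => /= h12.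
  rewrite (minn_idPl (ltnW h12)) (maxn_idPr (ltnW h12)).
  by rewrite (sorted_sort leq_trans) //=; lia.
rewrite (minn_idPr (ltnW h12)) (maxn_idPl (ltnW h12)).
set x := (s (f o0)).+1; set y := (s (f o1)).+1; set z := (s (f o2)).+1.
have -> : sort leq [:: x; y; z] = sort leq [:: x; z; y].
  by apply/(perm_sortP leq_total leq_trans anti_leq); rewrite perm_cons (perm_catC [:: y] [:: z]).
by rewrite (sorted_sort leq_trans) //=; lia.
Qed.

Lemma order_isomorphic_pattern b n (s : 'S_n) (f : {ffun 'I_3 -> 'I_n}) :
  order_isomorphic (mesh_perm (pattern b)) s f =
  [&& s (f o0) < s (f o1), s (f o0) < s (f o2)
    & on_side b (s (f o1)) (s (f o2))].
Proof.
rewrite /order_isomorphic forall_ord3 !forall_ord3.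
case: b => /=.
  by rewrite /perm123 !perm1 /=; lia.
have e0 : perm132 o0 = o0 by rewrite /perm132 permE.
have e1 : perm132 o1 = o2 by rewrite /perm132 permE.
have e2 : perm132 o2 = o1 by rewrite /perm132 permE.
by rewrite e0 e1 e2 /=; lia.
Qed.

(** The cells of column 3 force the last index to be the last position. The
cells of column 1 forbid, between the first two indices, every value below the
larger of the other two; this splits into the small values and those between
the middle value and t. The latter are also what the cell (0,2) forbids
before the first index, hence the single condition on all positions before the
middle one. Conversely that condition at the first index itself gives the
inequality between the first two values. *)
Lemma occurrenceP b N (s : 'S_N.+1) (f : {ffun 'I_3 -> 'I_N.+1}) :
  reflect
    [/\ f o2 = ord_max, f o0 < f o1, below_last s (f o0)
      & [/\ on_side b (s (f o1)) (s ord_max),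
        forall r : 'I_N.+1, f o0 < r < f o1 -> ~~ below_last s r
      & forall r : 'I_N.+1, r < f o1 -> ~~ strictly_between (s (f o1)) (s ord_max) (s r)]]
    (is_occurrence (pattern b) s f).
Proof.
have hs (x y : 'I_N.+1) : (s x == s y :> nat) = (x == y :> nat).
  by rewrite (inj_eq val_inj) (inj_eq perm_inj).
have -> : is_occurrence (pattern b) s f =
  [&& f o0 < f o1, f o0 < f o2 , f o1 < f o2,
    [&& s (f o0) < s (f o1), s (f o0) < s (f o2)
    & on_side b (s (f o1)) (s (f o2))] &
    [forall c in mesh_shading (pattern b), forall r : 'I_N.+1, ~~ in_cell s f c r]].
  rewrite /is_occurrence order_isomorphic_pattern /increasing_indices.
  rewrite forall_ord3 !forall_ord3 /= ?implybT /= -!andbA ?andbT /=.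
  by case: (f o0 < f o1); case: (f o0 < f o2); case: (f o1 < f o2).
have shadeE : mesh_shading (pattern b) = shadingR by case: b.
rewrite shadeE {shadeE}.
apply: (iffP idP).
  case/and5P=> p01 p02 p12 /and3P[v01 v02 v12] /forallP shaded.
  have free x y (hx : x < 4) (hy : y < 4) (r : 'I_N.+1) :
      (x, y) \in [:: (1, 0); (0, 2); (1, 1); (1, 2); (3, 0); (3, 1); (3, 2); (3, 3)] ->
      ~~ in_cell s f (Ordinal hx, Ordinal hy) r.
    move=> hxy; have := shaded (Ordinal hx, Ordinal hy).
    by rewrite inE /= hxy => /forallP.
  rewrite /in_cell position_boundsE (value_boundsE v01 v02 v12) /= in free.
  have last : f o2 = ord_max.
    apply: val_inj => /=; apply/eqP; rewrite eqn_leq -ltnS ltn_ord leqNgt /=.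
    apply/negP => hlt.
    move: (hs ord_max (f o0)) (hs ord_max (f o1)) (hs ord_max (f o2)).
    (* the last value would lie in one of the four rows of column 3 *)
    move: (free 3 0 isT isT ord_max isT) (free 3 1 isT isT ord_max isT).
    move: (free 3 2 isT isT ord_max isT) (free 3 3 isT isT ord_max isT).
    move: (ltn_ord (s ord_max)) => /=; lia.
  rewrite /below_last -last; split=> //; split=> // r hr.
    move: (free 1 0 isT isT r isT) (free 1 1 isT isT r isT) (free 1 2 isT isT r isT).
    move: (hs r (f o0)) (hs r (f o1)) => /=; lia.
  rewrite /strictly_between.
  move: (free 1 2 isT isT r isT) (free 0 2 isT isT r isT) => /=.
  have := hs r (f o0); lia.
case=> last p01 v02 [v12 gap near].
rewrite /below_last /strictly_between in v02 gap near.
have v01 : s (f o0) < s (f o1).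
  by move: (near _ p01) (hs (f o0) (f o1)) v12; rewrite /on_side; case: b; lia.
have p12 : f o1 < f o2.
  have := hs (f o1) (f o2); have := ltn_ord (f o1); rewrite last /=.
  by move: v12; rewrite /on_side; case: b; lia.
rewrite -last in v02 v12 gap near.
rewrite p01 (ltn_trans p01 p12) p12 v01 v02 v12 /=.
apply/forallP => -[x y]; apply/implyP; rewrite inE /= => hxy.
apply/forallP => r.
rewrite /in_cell position_boundsE (value_boundsE v01 v02 v12) /=.
move: (near r) (gap r) (hs r (f o0)) (hs r (f o1)) (hs r (f o2)).
have : r <= f o2 by rewrite last -ltnS ltn_ord.
clear near gap.
rewrite !inE !xpair_eqE in hxy.
by case: x y hxy => [[|[|[|[|//]]]] hx] [[|[|[|[|//]]]] hy] //= _; lia.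
Qed.

(** An occurrence is recovered from its middle index: the first index is the
last small position before it. *)
Lemma occurrences_records b N (s : 'S_N.+1) :
  occurrences (pattern b) s = records b s.
Proof.
rewrite /occurrences /records.
have inj : {in [set f | is_occurrence (pattern b) s f] &,
    injective (fun f : {ffun 'I_3 -> 'I_N.+1} => f o1)}.
  move=> f g; rewrite !inE => /occurrenceP[f2 f01 vf [_ gf _]] /occurrenceP[g2 g01 vg [_ gg _]] e.
  have e0 : f o0 = g o0.
    apply: val_inj; case: (ltngtP (f o0) (g o0)) => // h.
      by have := gf (g o0); rewrite h e g01 vg => /(_ isT).
    by have := gg (f o0); rewrite h -e f01 vf => /(_ isT).
  have e2 : f o2 = g o2 by rewrite f2 g2.
  apply/ffunP => -[[|[|[|//]]] h].
  - by have -> : Ordinal h = o0 by apply: val_inj.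
  - by have -> : Ordinal h = o1 by apply: val_inj.
  - by have -> : Ordinal h = o2 by apply: val_inj.
rewrite -(card_in_imset inj); apply: eq_card => i; rewrite inE.
apply/imsetP/and3P => [[f] | [side /existsP[p hp] /forallP near]].
  rewrite inE => /occurrenceP[_ f01 vf [side _ near]] ->; split=> //.
    by apply/existsP; exists (f o0); rewrite f01.
  by apply/forallP => r; apply/implyP => /near.
pose q := [arg max_(q > p | (q < i) && below_last s q) (q : nat)].
have [/andP[qi qb] qmax] : (q < i) && below_last s q /\
    forall r : 'I_N.+1, (r < i) && below_last s r -> r <= q.
  by rewrite /q; case: arg_maxnP => // q' hq' hmax; split.
exists [ffun a : 'I_3 => if a == o0 then q else if a == o1 then i else ord_max].
  rewrite inE; apply/occurrenceP; rewrite !ffunE /=; split=> //; split=> //.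
    move=> r /andP[qr ri]; apply/negP => hr.
    by have := qmax r; rewrite ri hr leqNgt qr => /(_ isT).
  by move=> r hr; have := near r; rewrite hr.
by rewrite ffunE.
Qed.

(** * Inserting a letter before the last one *)

Section Insertion.

Variable N : nat.
Implicit Types (s : 'S_N.+1) (j : 'I_N.+2).

Definition penultimate : 'I_N.+2 := widen_ord (leqnSn N.+1) ord_max.

Definition insert_letter j s : 'S_N.+2 := lift_perm penultimate j s.

(** Deleting the penultimate letter and standardizing is the inverse; equality of
the cardinals spares constructing it. *)
Lemma insert_letter_bij : bijective (fun x : 'I_N.+2 * 'S_N.+1 => insert_letter x.1 x.2).
Proof.
apply: inj_card_bij => [[j s] [j' s'] /= e|].
  have ej : j = j' by rewrite -(lift_perm_id penultimate j s) -(lift_perm_id penultimate j' s') -/(insert_letter _ _) e.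
  congr (_, _) => //; apply/permP => i; apply: (@lift_inj _ j).
  by rewrite -(lift_perm_lift penultimate) [in RHS]ej -(lift_perm_lift penultimate) -/(insert_letter _ _) e.
by rewrite card_prod !card_Sn card_ord factS.
Qed.

Lemma sum_insert_letter (F : 'S_N.+2 -> nat) :
  \sum_s F s = \sum_(s : 'S_N.+1) \sum_(j : 'I_N.+2) F (insert_letter j s).
Proof.
rewrite exchange_big pair_big /=.
by apply: reindex; apply: onW_bij; exact: insert_letter_bij.
Qed.

Lemma lift_penultimate_max : lift penultimate ord_max = ord_max :> 'I_N.+2.
Proof. by apply: val_inj; rewrite /= /bump leqnn. Qed.

Lemma insert_letter_last j s :
  insert_letter j s ord_max = lift j (s ord_max).
Proof. by rewrite -{1}lift_penultimate_max lift_perm_lift. Qed.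

Lemma insert_letter_new j s : insert_letter j s penultimate = j.
Proof. exact: lift_perm_id. Qed.

Lemma ltn_lift (j : 'I_N.+2) (a c : 'I_N.+1) : (lift j a < lift j c) = (a < c).
Proof. by rewrite /= /bump; lia. Qed.

(** Insertion keeps the relative order of the old letters, and the only old
letter after the new one is the last, which is never a record. *)
Lemma is_record_old b j s (i : 'I_N.+1) :
  is_record b (insert_letter j s) (lift penultimate i) = is_record b s i.
Proof.
rewrite /is_record /below_last insert_letter_last {1 4}/insert_letter.
rewrite lift_perm_lift -/(insert_letter j s).
have [-> | imax] := eqVneq i ord_max.
  by rewrite /on_side; case: b; rewrite !ltnn.
have iN : i < N.
  by move: imax (ltn_ord i); rewrite -(inj_eq val_inj) /=; lia.
have oldE (P : pred 'I_N.+2) :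
    [exists p : 'I_N.+2, (p < lift penultimate i) && P p] =
    [exists p : 'I_N.+1, (p < i) && P (lift penultimate p)].
  apply/existsP/existsP => [[p] | [p /andP[h hp]]]; last first.
    by exists (lift penultimate p); rewrite ltn_lift h.
  case: (unliftP penultimate p) => [q -> | ->].
    by rewrite ltn_lift => h; exists q.
  by rewrite /= /bump; lia.
congr [&& _, _ & _].
- by rewrite /on_side !ltn_lift.
- by rewrite oldE; apply: eq_existsb => p; rewrite lift_perm_lift ltn_lift.
apply: negb_inj; rewrite !negb_forall.
under eq_existsb => p do rewrite negb_imply negbK.
under [in RHS]eq_existsb => p do rewrite negb_imply negbK.
rewrite oldE; apply: eq_existsb => p.
by rewrite /strictly_between lift_perm_lift !ltn_lift.
Qed.

(** The last value t becomes t + 1 if j <= t and stays t otherwise. No letter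
separates the new one from the last one in value exactly when they are
adjacent: j = t just below, j = t + 1 just above. A small letter precedes the
new one exactly when there was one already, that is when t is not the least
value. *)
Lemma is_record_new b j s :
  is_record b (insert_letter j s) penultimate =
  (0 < s ord_max) && (j == s ord_max + ~~ b :> nat).
Proof.
have old (p : 'I_N.+1) : p < N ->
    (lift penultimate p < penultimate) /\ insert_letter j s (lift penultimate p) = lift j (s p).
  by move=> hp; split; [rewrite /= /bump; lia | exact: lift_perm_lift].
have at_value (x : nat) : x <= N -> x != s ord_max :> nat ->
    exists2 p : 'I_N.+1, p < N & s p = x :> nat.
  move=> xN xt; pose p := (s^-1)%g (inord x).
  have sp : s p = x :> nat by rewrite permKV inordK.
  exists p => //; rewrite ltn_neqAle -ltnS ltn_ord andbT.
  by apply: contraNneq xt => pN; rewrite -sp; apply/eqP; congr (val (s _)); apply: val_inj.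
rewrite /is_record /below_last insert_letter_last insert_letter_new.
have tN := ltn_ord (s ord_max); have jN := ltn_ord j.
apply/and3P/andP => [[side /existsP[p /andP[pN pb]] /forallP near] | [t0 /eqP jt]].
  have t0 : 0 < s ord_max.
    move: pN pb; case: (unliftP penultimate p) => [q -> _|->]; last by rewrite ltnn.
    by rewrite lift_perm_lift ltn_lift; apply: leq_ltn_trans.
  split=> //; apply/negPn/negP => jt.
  (* If j were not adjacent to the last value, the letter next to j in the
     direction of the last value would separate them. *)
  have nothing (x : nat) : x <= N -> x != s ord_max :> nat ->
      ~~ strictly_between j (lift j (s ord_max)) (bump j x).
    move=> xN xt; have [q qN <-] := at_value x xN xt.
    have [qlt qE] := old q qN.
    by have := near (lift penultimate q); rewrite qlt qE.
  move: side jt (nothing j) (nothing j.-1); rewrite /on_side /strictly_between /= /bump.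
  by case: b => /=; lia.
(* the letter of least value is small *)
have t0' : 0 != s ord_max :> nat by rewrite eq_sym -lt0n.
have [q qN q0] := at_value 0 isT t0'.
have [qlt qE] := old q qN.
split.
- by move: jt; rewrite /on_side /= /bump; case: (b) => /=; lia.
- by apply/existsP; exists (lift penultimate q); rewrite qlt qE ltn_lift q0.
apply/forallP => p; apply/implyP; case: (unliftP penultimate p) => [r ->|->]; last by rewrite ltnn.
move=> _; rewrite /insert_letter lift_perm_lift /strictly_between /= /bump.
by move: jt; case: (b) => /=; lia.
Qed.

Lemma records_insert_letter b j s :
  records b (insert_letter j s) =
  records b s + ((0 < s ord_max) && (j == s ord_max + ~~ b :> nat)).
Proof.
rewrite /records (cardsD1 penultimate) inE is_record_new addnC; congr (_ + _).
rewrite -(card_imset _ (@lift_inj _ penultimate)); apply: eq_card => i.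
rewrite !inE; apply/andP/imsetP => [[]|[k]].
  case: (unliftP penultimate i) => [k ->|-> /eqP//] _.
  by rewrite is_record_old => hk; exists k; rewrite ?inE.
by rewrite inE => hk ->; rewrite is_record_old eq_sym neq_lift.
Qed.

End Insertion.

(** * Symmetry of the joint distribution *)

(** The value of the sum does not depend on the position t of the two marked
choices; this lets the induction forget t itself. *)
Lemma sum_two_marked N (t : nat) (f : bool -> bool -> nat) : t <= N ->
  \sum_(j < N.+2) f (j == t :> nat) (j == t.+1 :> nat) =
  f true false + (f false true + N * f false false).
Proof.
move=> tN.
have h0 : t < N.+2 by rewrite ltnS ltnW.
have h1 : t.+1 < N.+2 by rewrite !ltnS.
rewrite (bigD1 (Ordinal h0)) //= (bigD1 (Ordinal h1)) //=; last first.
  by rewrite -(inj_eq val_inj) /= eq_sym neq_ltn ltnSn.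
rewrite !eqxx !(gtn_eqF (ltnSn t)) !(ltn_eqF (ltnSn t)); congr (_ + (_ + _)).
rewrite (eq_bigr (fun _ => f false false)) => [|j /andP[]]; last first.
  by rewrite -!(inj_eq val_inj) /= => /negPf-> /negPf->.
rewrite sum_nat_const; congr (_ * _).
suff cardN : #|~: [set Ordinal h0; Ordinal h1]| = N.
  rewrite -[RHS]cardN; apply: eq_card => j.
  by rewrite !inE negb_or.
by rewrite cardsCs setCK cards2 card_ord -(inj_eq val_inj) /= neq_ltn ltnSn subSS subSS subn0.
Qed.

(** The sum of F over all insertions into a permutation with statistics e, a
and c, where e tells whether the last value is not the least. In the second
case, only the insertion of a new least value makes the last value positive. *)
Definition insertion_sum N (F : bool -> nat -> nat -> nat) (e : bool) (a c : nat) : nat :=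
  if e then F true a.+1 c + (F true a c.+1 + N * F true a c)
  else \sum_(j < N.+2) F (j == 0 :> nat) a c.

Lemma sum_insertions N (F : bool -> nat -> nat -> nat) (s : 'S_N.+1) :
  \sum_j F (0 < insert_letter j s ord_max)
    (records true (insert_letter j s)) (records false (insert_letter j s)) =
  insertion_sum N F (0 < s ord_max) (records true s) (records false s).
Proof.
rewrite /insertion_sum; case: (posnP (s ord_max)) => [t0 | t0].
  apply: eq_bigr => j _.
  rewrite !records_insert_letter t0 !addn0 insert_letter_last /= t0 /bump.
  by rewrite leqn0 addn0 lt0b.
have tN : s ord_max <= N by rewrite -ltnS ltn_ord.
have := sum_two_marked
  (fun u v => F true (records true s + u) (records false s + v)) tN.
rewrite !addn0 !addn1 => <-; apply: eq_bigr => j _.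
by rewrite !records_insert_letter t0 insert_letter_last /= addn0 addn1 addn_gt0 t0 orbT.
Qed.

(** The function F is arbitrary so that the induction hypothesis applies to
[insertion_sum N F]; exchanging the statistics in F merely exchanges the two
special insertions. *)
Lemma sum_records_sym N (F : bool -> nat -> nat -> nat) :
  \sum_(s : 'S_N.+1) F (0 < s ord_max) (records true s) (records false s) =
  \sum_(s : 'S_N.+1) F (0 < s ord_max) (records false s) (records true s).
Proof.
elim: N F => [|N IH] F.
  apply: eq_bigr => s _.
  suff h b : records b s = 0 by rewrite !h.
  apply: eq_card0 => i; rewrite inE; apply/negP => /and3P[_ /existsP[p]].
  by rewrite (ord1 i) ltn0.
rewrite !sum_insert_letter.
under eq_bigr => s _ do rewrite sum_insertions.
under [RHS]eq_bigr => s _ do rewrite (sum_insertions (fun e a c => F e c a)).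
rewrite IH; apply: eq_bigr => s _.
by rewrite /insertion_sum; case: ifP => // _; rewrite addnCA.
Qed.

Theorem mainTheorem6 (n : nat) (hn : 1 <= n) (k l : nat) :
  #|[set s : 'S_n | (occurrences P11 s == k) && (occurrences P12 s == l)]| =
  #|[set s : 'S_n | (occurrences P12 s == k) && (occurrences P11 s == l)]|.
Proof.
case: n hn => // N _.
rewrite -!sum1dep_card big_mkcond [RHS]big_mkcond /=.
transitivity (\sum_(s : 'S_N.+1)
  if (records true s == k) && (records false s == l) then 1 else 0).
  by apply: eq_bigr => s _; rewrite -!occurrences_records.
rewrite (sum_records_sym N (fun _ a c => if (a == k) && (c == l) then 1 else 0)).
by apply: eq_bigr => s _; rewrite -!occurrences_records.
Qed.
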